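(* Let $r_1,\dots,r_\ell$ be non-negative integers and let $H$ be a $K(r_1,\dots,r_\ell)$-decomposable graph. Then for every $\eta>0$ there exist $\rho=\rho(\eta,H)>0$ and $n_0$ such that for every $d$ and every $(\rho,d)$-dense graph $G$ with $|V(G)|\ge n_0$, \[ t_H(G)\ge d^{|E(H)|}-\eta. \]
   Context: All graphs are finite and simple. $K(r_1,\dots,r_\ell)$ denotes the complete $\ell$-partite graph with parts of sizes $r_1,\dots,r_\ell$. For graphs $H,G$, $\mathrm{Hom}(H,G)$ is the set of graph homomorphisms from $H$ to $G$, and $t_H(G)=|\mathrm{Hom}(H,G)|/|V(G)|^{|V(H)|}$. A graph $G$ is $(\rho,d)$-dense if every $X\subseteq V(G)$ with $|X|\ge\rho|V(G)|$ spans at least $\frac d2|X|^2$ edges. A tree decomposition of $H$ is a pair $(\mathcal F,\mathcal T)$, $\mathcal F$ a family of subsets of $V(H)$ and $\mathcal T$ a tree on vertex set $\mathcal F$, such that (1) $\bigcup_{X\in\mathcal F}X=V(H)$; (2) every edge of $H$ lies in some $X\in\mathcal F$; (3) $X\cap Y\subseteq Z$ whenever $Z$ lies on the $\mathcal T$-path from $X$ to $Y$. For a graph $J$, a $J$-decomposition of $H$ is a tree decomposition $(\mathcal F,\mathcal T)$ such that each $H[X]$, $X\in\mathcal F$, is isomorphic to $J$, and for every pair $X,Y$ adjacent in $\mathcal T$ there is an isomorphism between $H[X]$ and $H[Y]$ fixing $X\cap Y$ pointwise. $H$ is $J$-decomposable if it has a $J$-decomposition.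
   Formalization: ''For every d'' is taken as every d ≥ 0: for d < 0 every graph is (ρ,d)-dense, and the inequality fails, e.g. for H = K(1,2), d = −1, η = 1/2 and G edgeless. *)

(* Defs.v *)
From HB Require Import structures.
From mathcomp Require Import all_boot all_order all_algebra.
From mathcomp Require Import reals.

Set Implicit Arguments.
Unset Strict Implicit.
Unset Printing Implicit Defensive.

Import Order.TTheory GRing.Theory Num.Theory.

Local Open Scope ring_scope.

(* The record coerces to its adjacency relation: [G x y] reads "xy is an edge". *)
Record sgraph (V : finType) := SGraph {
  adj :> rel V;
  adj_sym : symmetric adj;
  adj_irr : irreflexive adj }.

Definition edges (V : finType) (G : sgraph V) : {set {set V}} :=
  [set [set xy.1; xy.2] | xy in [pred xy : V * V | G xy.1 xy.2]].

Section Induced.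
Variables (V : finType) (G : sgraph V) (X : {set V}).

Definition induced_adj : rel {x : V | x \in X} :=
  fun x y => G (val x) (val y).

Lemma induced_sym : symmetric induced_adj.
Proof. by move=> x y; exact: adj_sym. Qed.

Lemma induced_irr : irreflexive induced_adj.
Proof. by move=> x; exact: adj_irr. Qed.

Definition induced : sgraph {x : V | x \in X} :=
  SGraph induced_sym induced_irr.
End Induced.

Section CompleteMultipartite.
Variables (l : nat) (r : 'I_l -> nat).

Definition multipartite_adj : rel {i : 'I_l & 'I_(r i)} :=
  fun u v => tag u != tag v.

Lemma multipartite_sym : symmetric multipartite_adj.
Proof. by move=> u v; rewrite /multipartite_adj eq_sym. Qed.

Lemma multipartite_irr : irreflexive multipartite_adj.
Proof. by move=> u; rewrite /multipartite_adj eqxx. Qed.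

Definition complete_multipartite : sgraph {i : 'I_l & 'I_(r i)} :=
  SGraph multipartite_sym multipartite_irr.
End CompleteMultipartite.

Definition is_iso (V W : finType) (G : sgraph V) (K : sgraph W) (f : V -> W) :=
  bijective f /\ forall x y, K (f x) (f y) = G x y.

(* [ucycle] admits x, y, x as a closed walk, hence the bound on the length. *)
Definition is_tree (V : finType) (T : sgraph V) : Prop :=
  [/\ (0 < #|V|)%N,
      forall x y, connect T x y
    & forall c : seq V, (2 < size c)%N -> ~ ucycle T c].

Definition tree_path (V : finType) (T : sgraph V) (x y : V) (p : seq V) :=
  [/\ path T x p, uniq (x :: p) & last x p = y].

Definition tree_decomposition (V : finType) (H : sgraph V)
    (F : {set {set V}}) (T : sgraph {X : {set V} | X \in F}) : Prop :=
  [/\ is_tree T,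
      \bigcup_(X in F) X = [set: V],
      forall x y, H x y -> exists2 X, X \in F & (x \in X) && (y \in X)
    & forall X Y Z p, tree_path T X Y p -> Z \in X :: p ->
        val X :&: val Y \subset val Z].

Definition is_J_decomposition (U V : finType) (J : sgraph U) (H : sgraph V)
    (F : {set {set V}}) (T : sgraph {X : {set V} | X \in F}) : Prop :=
  [/\ tree_decomposition H T,
      forall X, X \in F -> exists f, is_iso (induced H X) J f
    & forall X Y, T X Y ->
        exists2 f, is_iso (induced H (val X)) (induced H (val Y)) f
        & forall v, val v \in val Y -> val (f v) = val v].

Definition decomposable (U V : finType) (J : sgraph U) (H : sgraph V) : Prop :=
  exists F : {set {set V}}, exists T : sgraph {X : {set V} | X \in F},
    is_J_decomposition J H T.

Definition Hom (V W : finType) (H : sgraph V) (G : sgraph W) :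
    {set {ffun V -> W}} :=
  [set f : {ffun V -> W} | [forall x, forall y, H x y ==> G (f x) (f y)]].

Definition hom_density (R : realType) (V W : finType)
    (H : sgraph V) (G : sgraph W) : R :=
  #|Hom H G|%:R / #|W|%:R ^+ #|V|.

Definition dense_graph (R : realType) (rho d : R) (W : finType) (G : sgraph W) :=
  forall X : {set W}, rho * #|W|%:R <= #|X|%:R ->
    d / 2 * #|X|%:R ^+ 2 <= #|[set e in edges G | e \subset X]|%:R.

(* Main.v *)
Require Import Defs.
From HB Require Import structures.
From mathcomp Require Import all_boot all_order all_algebra.
From mathcomp Require Import reals.
From mathcomp Require Import ring lra.

Set Implicit Arguments.
Unset Strict Implicit.
Unset Printing Implicit Defensive.

Import Order.TTheory GRing.Theory Num.Theory.

Local Open Scope ring_scope.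

(* Let J be the complete multipartite graph and write t_X for the density of H[X].  In a maximal
   independent class A of a bag, all vertices see the same remaining part B; by local density inside
   the common neighbourhood of B and convexity, adding a vertex adjacent to S multiplies the density
   by at least d^deg, up to an error O(rho).  Iterating, t_Y >= d^(e(Y) - e(S)) t_S - O(rho) for
   every subset S of a bag Y.
   The bags are then glued along the tree: choosing the bags one by one, each conditionally
   independent of the previous ones given its intersection S with its neighbour, defines a
   distribution on Hom(H, G) whose marginal on every bag is uniform on Hom(J, G).  The AM-GM
   inequality (in place of an entropy computation) shows t_H >= t_J prod_S (t_J / t_S), and the
   first part bounds each factor from below by d^(e(J) - e(S)).  *)

(** * Averages over maps *)

Section Average.
Variables (R : realType) (V W : finType).
Hypothesis W_gt0 : (0 < #|W|)%N.
Implicit Types (F : {ffun V -> W} -> R) (f g : {ffun V -> W}) (S X Y U : {set V}).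

Definition av F : R := (\sum_f F f) / #|W|%:R ^+ #|V|.

Lemma cardW_gt0 : 0 < #|W|%:R :> R.
Proof. by rewrite ltr0n. Qed.

Lemma eq_av F1 F2 : F1 =1 F2 -> av F1 = av F2.
Proof. by move=> eqF; rewrite /av (eq_bigr F2). Qed.

Lemma av_ge0 F : (forall f, 0 <= F f) -> 0 <= av F.
Proof. by move=> F0; rewrite divr_ge0 ?sumr_ge0 ?exprn_ge0. Qed.

Lemma ler_av F1 F2 : (forall f, F1 f <= F2 f) -> av F1 <= av F2.
Proof.
move=> leF; rewrite ler_wpM2r ?ler_sum //.
by rewrite invr_ge0 exprn_ge0.
Qed.

Lemma avD F1 F2 : av (fun f => F1 f + F2 f) = av F1 + av F2.
Proof. by rewrite /av big_split mulrDl. Qed.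

Lemma avZ a F : av (fun f => a * F f) = a * av F.
Proof. by rewrite /av -mulr_sumr mulrA. Qed.

Lemma av1 : av (fun=> 1) = 1.
Proof.
rewrite /av sumr_const card_ffun natrX mulfV //.
by rewrite expf_neq0 // gt_eqF ?cardW_gt0.
Qed.

Lemma av_cst a : av (fun=> a) = a.
Proof. by rewrite -[in RHS](mulr1 a) -av1 -avZ; apply: eq_av => f; rewrite mulr1. Qed.

Lemma av_sum (I : finType) (F : I -> {ffun V -> W} -> R) :
  av (fun f => \sum_i F i f) = \sum_i av (F i).
Proof. by rewrite /av exchange_big mulr_suml. Qed.

Lemma av_prod (A : {set V}) (phi : W -> R) :
  av (fun f => \prod_(x in A) phi (f x)) = ((\sum_w phi w) / #|W|%:R) ^+ #|A|.
Proof.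
rewrite /av; pose h x w := if x \in A then phi w else 1.
transitivity ((\sum_(f : {ffun V -> W}) \prod_x h x (f x)) / #|W|%:R ^+ #|V|).
  congr (_ / _); apply: eq_bigr => f _.
  by rewrite big_mkcond; apply: eq_bigr => x _; rewrite /h; case: ifP.
have -> : (#|W|%:R ^+ #|V|)^-1 = \prod_(x : V) #|W|%:R^-1 :> R.
  by rewrite prodr_const exprVn.
rewrite -bigA_distr_bigA /= -prodr_const.
rewrite -big_split [RHS]big_mkcond; apply: eq_bigr => x _ /=; rewrite /h.
case: ifP => // _; rewrite sumr_const mulfV // gt_eqF //; exact: cardW_gt0.
Qed.

(** * Conditional averages and independence *)

Definition mix S f g : {ffun V -> W} := [ffun x => if x \in S then f x else g x].

(* The conditional expectation of [F] given the restriction of [f] to [S]. *)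
Definition cav S F f : R := av (fun g => F (mix S f g)).

Definition depends (T : Type) S (F : {ffun V -> W} -> T) :=
  forall f g, {in S, f =1 g} -> F f = F g.

(** Exchanging the values on [S] of two maps is an involution on pairs, with [mix S f g] as second
    component. *)
Lemma av_cav S F : av (cav S F) = av F.
Proof.
rewrite -[RHS]av_cst /cav /av -!mulr_suml; congr (_ / _ / _).
rewrite !pair_big /=.
pose s (p : {ffun V -> W} * {ffun V -> W}) := (mix S p.2 p.1, mix S p.1 p.2).
have sK : involutive s.
  by case=> f g; rewrite /s /=; congr (_, _); apply/ffunP => x;
    rewrite !ffunE; case: ifP => // ->.
by rewrite [RHS](reindex_inj (inv_inj sK)).
Qed.

Lemma depends_cav S F : depends S (cav S F).
Proof.
move=> f g eqfg; apply: eq_av => h; congr F; apply/ffunP => x.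
by rewrite !ffunE; case: ifP => // /eqfg.
Qed.

Lemma dependsS (T : Type) S U (F : {ffun V -> W} -> T) :
  S \subset U -> depends S F -> depends U F.
Proof. by move=> /subsetP sSU dF f g eqfg; apply: dF => x /sSU /eqfg. Qed.

Lemma av_indep S U Y F1 F2 : depends U F1 -> depends Y F2 ->
  S \subset U -> Y :&: U \subset S ->
  av (fun f => F1 f * F2 f) = av (fun f => F1 f * cav S F2 f).
Proof.
move=> dF1 dF2 /subsetP sSU /subsetP sYU.
rewrite -(av_cav U); apply: eq_av => f; rewrite /cav -avZ.
apply: eq_av => g; congr (_ * _).
  by apply: dF1 => x xU; rewrite ffunE xU.
apply: dF2 => x xY; rewrite !ffunE.
case: (boolP (x \in U)) => xU; first by rewrite sYU // inE xY.
by case: ifP => // /sSU; rewrite (negPf xU).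
Qed.

End Average.

(** * Local density *)

Section DensePairs.
Variables (R : realType) (W : finType) (G : sgraph W).
Implicit Types (N : {set W}).

(** Each edge is spanned by two ordered pairs, distinct because there are no loops. *)
Lemma edges_in_le_pairs N :
  (#|[set e in edges G | e \subset N]|.*2 <= \sum_(u in N) \sum_(v in N) G u v)%N.
Proof.
pose E := [set e in edges G | e \subset N].
pose P := [pred p : W * W | [&& p.1 \in N, p.2 \in N & G p.1 p.2]].
have -> : (\sum_(u in N) \sum_(v in N) G u v = \sum_(p | P p) 1)%N.
  rewrite pair_big /= [LHS]big_mkcond [RHS]big_mkcond; apply: eq_bigr => -[u v] _ /=.
  by case: (u \in N); case: (v \in N); case: (G u v).
pose st (p : W * W) := [set p.1; p.2].
rewrite (partition_big st (mem E)) /=; last first.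
  move=> [u v] /and3P[/= uN vN Guv]; rewrite inE subUset !sub1set uN vN !andbT.
  by rewrite /edges; apply/imsetP; exists (u, v).
rewrite -muln2 -sum_nat_const; apply: leq_sum => e.
rewrite inE /edges => /andP[/imsetP[[u v] /= Guv ->]].
rewrite inE /= in Guv; rewrite subUset !sub1set => /andP[uN vN].
have uv : u != v by apply: contraTneq Guv => ->; rewrite adj_irr.
rewrite sum1_card.
have -> : 2%N = #|[set (u, v); (v, u)]|.
  by rewrite cards2 xpair_eqE (negPf uv).
apply/subset_leq_card/subsetP => p; rewrite !inE => /orP[] /eqP-> /=.
  by rewrite unfold_in /= uN vN Guv eqxx.
by rewrite unfold_in /= uN vN adj_sym Guv /st /= setUC eqxx.
Qed.

Variables (rho d : R).
Hypotheses (rho_gt0 : 0 < rho) (rho_le1 : rho <= 1) (W_gt0 : (0 < #|W|)%N).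
Hypotheses (d_ge0 : 0 <= d) (G_dense : dense_graph rho d G).
Let n : R := #|W|%:R.

Let n_gt0 : 0 < n.
Proof. by rewrite ltr0n. Qed.

Lemma dense_pairs_big N : rho * n <= #|N|%:R ->
  d * #|N|%:R ^+ 2 <= \sum_(u in N) \sum_(v in N) (G u v)%:R.
Proof.
move=> /G_dense dN; have := edges_in_le_pairs N.
rewrite -(ler_nat R) -muln2 natrM natr_sum.
under eq_bigr do rewrite natr_sum.
by lra.
Qed.

Lemma dense_le1 : d <= 1.
Proof.
have := @dense_pairs_big [set: W]; rewrite cardsT -/n .
rewrite ger_pMl // => /(_ rho_le1) le_d; have : d * n ^+ 2 <= 1 * n ^+ 2.
  apply: le_trans le_d _; rewrite mul1r expr2 mulr_natl -[n *+ _]/(n *+ #|xpredT : pred W|).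
  rewrite -sumr_const.
  under eq_bigl do rewrite inE.
  apply: ler_sum => u _; rewrite /n -sumr_const.
  under eq_bigl do rewrite inE.
  by apply: ler_sum => v _; case: (G u v); rewrite ?ler01.
by rewrite ler_pM2r // exprn_gt0.
Qed.

(** The error [rho] absorbs the sets too small for the density hypothesis: for them the left side is
    at most 0. *)
Lemma dense_pairs N :
  d * (#|N|%:R / n) ^+ 2 - rho <=
    (\sum_(u in N) (\sum_(v in N) (G v u)%:R) / n) / n.
Proof.
have n2 : n != 0 by rewrite gt_eqF.
case: (leP (rho * n) #|N|%:R) => [/dense_pairs_big|] ltN.
  rewrite -mulr_suml (eq_bigr (fun u => \sum_(v in N) (G u v)%:R)); last first.
    by move=> u _; apply: eq_bigr => v _; rewrite adj_sym.
  rewrite -mulrA -invfM -expr2 lerBlDr.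
  apply: (@le_trans _ _ (d * #|N|%:R ^+ 2 / n ^+ 2)).
    by rewrite expr_div_n mulrA.
  rewrite -[leLHS]addr0 lerD ?(ltW rho_gt0) // ler_wpM2r //.
  by rewrite invr_ge0 exprn_ge0 // ltW.
apply: (@le_trans _ _ 0); last first.
  by rewrite divr_ge0 ?sumr_ge0 // ?(ltW n_gt0) // => u _; rewrite divr_ge0 ?sumr_ge0 ?(ltW n_gt0).
rewrite subr_le0; set x := #|N|%:R / n.
have x0 : 0 <= x by rewrite divr_ge0 // ltW.
have xrho : x <= rho by rewrite ler_pdivrMr // ltW.
have x21 : x ^+ 2 <= rho.
  by rewrite expr2 (le_trans (ler_pM x0 x0 xrho (le_trans xrho rho_le1))) ?mulr1.
by apply: le_trans x21; rewrite ler_piMl ?exprn_ge0 ?dense_le1.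
Qed.

(** Convexity in tangent form. In the induction, the two bounds differ by a non-negative multiple of
    [(g - c) ^+ 2]. *)
Lemma expr_tangent (g c : R) k : 0 <= g -> 0 <= c ->
  c ^+ k + k%:R * c ^+ k.-1 * (g - c) <= g ^+ k.
Proof.
move=> g0 c0; elim: k => [|k IHk]; first by rewrite !mul0r addr0.
rewrite /= exprS [g ^+ k.+1]exprS; apply: le_trans (ler_wpM2l g0 IHk).
rewrite -subr_ge0.
case: k {IHk} => [|k]; first by rewrite /=; lra.
rewrite /= -[in k.+2%:R]natr1 [c ^+ k.+1]exprS.
set K := k.+1%:R; set C := c ^+ k.
have -> : g * (c * C + K * C * (g - c)) - (c * (c * C) + (K + 1) * (c * C) * (g - c))
  = K * C * (g - c) ^+ 2 by ring.
by rewrite mulr_ge0 ?sqr_ge0 // mulr_ge0 ?exprn_ge0.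
Qed.

(* The tangent line of [g ^ k] at [d x] replaces the power mean inequality, avoiding a division by
   the possibly vanishing [x]. *)
Lemma dense_degree_moment N k :
  d ^+ k * (#|N|%:R / n) ^+ k.+1 - k%:R * rho <=
    (\sum_(u in N) ((\sum_(v in N) (G v u)%:R) / n) ^+ k) / n.
Proof.
set x := #|N|%:R / n; pose g u : R := (\sum_(v in N) (G v u)%:R) / n.
rewrite -[leRHS]/((\sum_(u in N) g u ^+ k) / n).
have x0 : 0 <= x by rewrite divr_ge0 // ltW.
have x1 : x <= 1 by rewrite ler_pdivrMr // mul1r ler_nat max_card.
set c := d * x.
have c0 : 0 <= c by rewrite mulr_ge0.
have c1 : c <= 1 by rewrite mulr_ile1 // dense_le1.
have g0 u : 0 <= g u by rewrite divr_ge0 ?sumr_ge0 // ltW.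
set s := (\sum_(u in N) g u) / n.
have les : d * x ^+ 2 - rho <= s by exact: dense_pairs.
(* The middle term is the tangent bound at [c = d * x], summed over [N] and divided by [n]; since
   [s - x * c >= - rho] and [c <= 1], its linear part costs at most [k%:R * rho]. *)
apply: (@le_trans _ _ (x * c ^+ k + k%:R * c ^+ k.-1 * (s - x * c))); last first.
  have -> : x * c ^+ k + k%:R * c ^+ k.-1 * (s - x * c) =
     (\sum_(u in N) (c ^+ k + k%:R * c ^+ k.-1 * (g u - c))) / n.
    rewrite big_split /= sumr_const -mulr_sumr big_split /= sumr_const /s /x.
    rewrite -(mulr_natr (c ^+ k)) -(mulr_natr (- c)).
    move: (\sum_(_ in _) _) (c ^+ k) (c ^+ k.-1) (k%:R : R) (#|N|%:R : R) (n^-1).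
    by move: (c : R) => c' S C D K m v; ring.
  rewrite ler_wpM2r ?invr_ge0 ?(ltW n_gt0) // ler_sum // => u _.
  exact: expr_tangent.
have -> : d ^+ k * x ^+ k.+1 = x * c ^+ k.
  by rewrite [x ^+ k.+1]exprS mulrCA -exprMn.
rewrite lerD2l -mulrN -mulrA ler_wpM2l //.
have : - rho <= s - x * c.
  apply: le_trans (_ : d * x ^+ 2 - rho - x * c <= _); last by rewrite lerD2r.
  by rewrite /c expr2; move: (d) (rho) (x) => D r z; lra.
move: (s - x * c) => y y_ge; apply: (@le_trans _ _ (c ^+ k.-1 * - rho)).
  by rewrite mulrN lerN2 ler_piMl ?exprn_ile1 // ltW.
by rewrite ler_wpM2l ?exprn_ge0.
Qed.

End DensePairs.

(** * Homomorphisms from complete multipartite graphs *)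

Section Homs.
Variables (R : realType) (V W : finType) (H : sgraph V) (G : sgraph W).
Implicit Types (f g : {ffun V -> W}) (A B S X Y : {set V}).

(* Homomorphisms of [H[X]] are encoded by total maps, of which only the values on [X] matter, so
   that all averages run over the same space. *)
Definition hom_on X f : bool :=
  [forall x in X, forall y in X, H x y ==> G (f x) (f y)].

Definition homI X f : R := (hom_on X f)%:R.

Definition common B f : {set W} := [set w | [forall b in B, G w (f b)]].

Lemma hom_onP X f :
  reflect (forall x y, x \in X -> y \in X -> H x y -> G (f x) (f y)) (hom_on X f).
Proof.
apply: (iffP forall_inP) => [hf x y xX yX Hxy | hf x xX].
  by move/forall_inP: (hf x xX) => /(_ y yX) /implyP; exact.
by apply/forall_inP => y yX; apply/implyP; exact: hf.
Qed.

Lemma homI_ge0 X f : 0 <= homI X f.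
Proof. by rewrite ler0n. Qed.

Lemma homI_sub S X f : S \subset X -> homI X f <= homI S f.
Proof.
move=> /subsetP sSX; rewrite ler_nat; case: (boolP (hom_on X f)) => // /hom_onP hf.
by suff -> : hom_on S f by []; apply/hom_onP => x y xS yS; apply: hf; exact: sSX.
Qed.

Lemma depends_hom_on X : depends X (hom_on X).
Proof.
move=> f g eqfg; apply/hom_onP/hom_onP => hf x y xX yX Hxy.
  by rewrite -!eqfg //; exact: hf.
by rewrite !eqfg //; exact: hf.
Qed.

Lemma depends_homI X : depends X (homI X).
Proof. by move=> f g eqfg; rewrite /homI (depends_hom_on eqfg). Qed.

Lemma depends_common B : depends B (common B).
Proof.
move=> f g eqfg; apply/setP => w; rewrite !inE.
by apply/forall_inP/forall_inP => hw b bB; [rewrite -eqfg | rewrite eqfg] => //; exact: hw.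
Qed.

Lemma commonU A B f w :
  (w \in common (A :|: B) f) = (w \in common B f) && [forall a in A, G w (f a)].
Proof.
rewrite !inE; apply/forall_inP/andP => [hw | [/forall_inP hB /forall_inP hA] b].
  by split; apply/forall_inP => b bB; apply: hw; rewrite inE bB ?orbT.
by rewrite inE => /orP[/hA|/hB].
Qed.

(** [A] is independent and completely joined to [B], so its vertices can be placed freely in the
    common neighbourhood. *)
Lemma hom_onU A B f : {in A &, forall x y, ~~ H x y} ->
    {in A & B, forall x y, H x y} ->
  hom_on (A :|: B) f = hom_on B f && [forall a in A, f a \in common B f].
Proof.
move=> A0 AB; apply/hom_onP/andP => [hf | [/hom_onP hB /forall_inP hA] x y].
  split; first by apply/hom_onP => x y xB yB; apply: hf; rewrite inE ?xB ?yB orbT.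
  apply/forall_inP => a aA; rewrite inE; apply/forall_inP => b bB.
  by apply: hf; rewrite ?inE ?aA ?bB ?orbT //; exact: AB.
rewrite !inE => /orP[xA|xB] /orP[yA|yB] Hxy.
- by have := A0 x y xA yA; rewrite Hxy.
- by have := hA x xA; rewrite inE => /forall_inP /(_ y yB).
- by rewrite adj_sym; have := hA y yA; rewrite inE => /forall_inP /(_ x xB).
- exact: hB.
Qed.

Hypothesis W_gt0 : (0 < #|W|)%N.
Let n : R := #|W|%:R.

Let n_gt0 : 0 < n.
Proof. by rewrite ltr0n. Qed.

(** Given the values on [B], those on [A] are independent and uniform. *)
Lemma av_split_prod A B (F : {ffun V -> W} -> R) (phi : {ffun V -> W} -> W -> R) :
    [disjoint A & B] -> depends B F -> depends B phi ->
  av (fun f => F f * \prod_(a in A) phi f (f a)) =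
  av (fun f => F f * ((\sum_w phi f w) / n) ^+ #|A|).
Proof.
move=> dAB dF dphi; rewrite -(av_cav W_gt0 B); apply: eq_av => f.
rewrite -(av_prod W_gt0) /cav -avZ; apply: eq_av => g.
have eqm : {in B, mix B f g =1 f} by move=> x xB; rewrite ffunE xB.
rewrite (dF _ _ eqm) (dphi _ _ eqm); congr (_ * _); apply: eq_bigr => a aA.
by rewrite ffunE (disjointFr dAB aA).
Qed.

Definition common_frac B f : R := #|common B f|%:R / n.

Lemma common_frac_ge0 B f : 0 <= common_frac B f.
Proof. by rewrite divr_ge0 // ltW. Qed.

Lemma prod_natb (I : finType) (P Q : pred I) :
  \prod_(i | P i) (Q i)%:R = [forall (i | P i), Q i]%:R :> R.
Proof.
case: (boolP [forall (i | P i), Q i]) => [/forall_inP hQ | ].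
  by rewrite big1 // => i /hQ ->.
rewrite negb_forall => /existsP[i]; rewrite negb_imply => /andP[Pi /negPf Qi].
by rewrite (bigD1 i) //= Qi mul0r.
Qed.

Lemma sum_natb_set (N : {set W}) : \sum_w (w \in N)%:R = #|N|%:R :> R.
Proof.
by rewrite -sum1_card natr_sum [RHS]big_mkcond; apply: eq_bigr => w _; case: ifP.
Qed.

Lemma av_homIU A B : [disjoint A & B] -> {in A &, forall x y, ~~ H x y} ->
    {in A & B, forall x y, H x y} ->
  av (homI (A :|: B)) = av (fun f => homI B f * common_frac B f ^+ #|A|).
Proof.
move=> dAB A0 AB.
transitivity (av (fun f => homI B f * \prod_(a in A) (f a \in common B f)%:R : R)).
  by apply: eq_av => f; rewrite prod_natb -natrM mulnb /homI hom_onU.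
rewrite (av_split_prod (phi := fun f w => (w \in common B f)%:R) dAB).
- by apply: eq_av => f; rewrite sum_natb_set.
- exact: depends_homI.
- by move=> f g eqfg; rewrite (depends_common eqfg).
Qed.

(** * Adding vertices in a locally dense graph *)

Variables (rho d : R).
Hypotheses (rho_gt0 : 0 < rho) (rho_le1 : rho <= 1).
Hypotheses (d_ge0 : 0 <= d) (G_dense : dense_graph rho d G).

Let d_le1 : d <= 1.
Proof. exact: (dense_le1 rho_le1 W_gt0 G_dense). Qed.

(** The right side adds a vertex [w] joined to all of [A :|: B]. Choosing [w] before [A] turns it
    into an [#|A|]-th moment of degrees inside [common B f], where local density applies. *)
Lemma av_common_fracU A B : [disjoint A & B] -> {in A &, forall x y, ~~ H x y} ->
    {in A & B, forall x y, H x y} ->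
  d ^+ #|A| * av (fun f => homI B f * common_frac B f ^+ #|A|.+1) - #|A|%:R * rho
    <= av (fun f => homI (A :|: B) f * common_frac (A :|: B) f).
Proof.
move=> dAB A0 AB.
have -> : av (fun f => homI (A :|: B) f * common_frac (A :|: B) f) =
   av (fun f => homI B f * ((\sum_(w in common B f)
      ((\sum_(v in common B f) (G v w)%:R) / n) ^+ #|A|) / n)).
  transitivity (\sum_w av (fun f => (homI B f * (w \in common B f)%:R / n) *
      \prod_(a in A) ((f a \in common B f) && G (f a) w)%:R)).
    rewrite -av_sum; apply: eq_av => f.
    rewrite /common_frac -sum_natb_set mulr_suml mulr_sumr; apply: eq_bigr => w _.
    rewrite prod_natb commonU /homI hom_onU // !mulrA -!natrM mulrAC -natrM !mulnb.
    congr (_%:R / _).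
    have -> : [forall (a | a \in A), (f a \in common B f) && G (f a) w] =
        [forall a in A, f a \in common B f] && [forall a in A, G w (f a)].
      apply/forall_inP/andP => [hA | [/forall_inP h1 /forall_inP h2] a aA].
        by split; apply/forall_inP => a /hA /andP[? ?] //; rewrite adj_sym.
      by rewrite h1 //= adj_sym h2.
    by case: (hom_on B f) (w \in _) => [] [] //=; rewrite ?andbF.
  rewrite (eq_bigr (fun w => av (fun f => (homI B f * (w \in common B f)%:R / n) *
      ((\sum_v ((v \in common B f) && G v w)%:R) / n) ^+ #|A|))); last first.
    move=> w _.
    rewrite (av_split_prod (phi := fun f v => ((v \in common B f) && G v w)%:R) dAB) //.
      by move=> f g eqfg; rewrite (depends_common eqfg) (depends_homI eqfg).
    by move=> f g eqfg; rewrite (depends_common eqfg).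
  rewrite -av_sum; apply: eq_av => f.
  rewrite mulr_suml mulr_sumr [RHS]big_mkcond; apply: eq_bigr => w _ /=.
  case: ifP => _; last by rewrite mulr0 !mul0r.
  rewrite mulr1 -!mulrA; congr (_ * _); rewrite mulrC; congr (_ ^+ _ / _); congr (_ / _).
  by rewrite [RHS]big_mkcond; apply: eq_bigr => v _; case: ifP.
rewrite lerBlDr -avZ -[X in _ <= _ + X](av_cst V W_gt0) -avD; apply: ler_av => f.
have := dense_degree_moment rho_gt0 rho_le1 W_gt0 d_ge0 G_dense (common B f) #|A|.
rewrite -/n -/(common_frac B f).
rewrite lerBlDr /homI; case: (hom_on B f); first by rewrite !mul1r.
by rewrite !mul0r mulr0 add0r mulr_ge0 // ltW.
Qed.

(* Pointwise, [x ^ k (x - D) >= D ^ k (x - D)]. *)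
Lemma av_moment_succ B (D eps : R) k : 0 <= D -> D <= 1 -> 0 <= eps ->
  D * av (homI B) - eps <= av (fun f => homI B f * common_frac B f) ->
  D * av (fun f => homI B f * common_frac B f ^+ k) - eps <=
    av (fun f => homI B f * common_frac B f ^+ k.+1).
Proof.
move=> D0 D1 eps0 le1.
pose F i := av (fun f => homI B f * common_frac B f ^+ i).
have leD f : D ^+ k * (common_frac B f - D) <= common_frac B f ^+ k * (common_frac B f - D).
  move: (common_frac_ge0 B f); move: (common_frac B f) => x x0.
  case: (lerP D x) => Dx.
    by apply: ler_wpM2r; [rewrite subr_ge0 | rewrite lerXn2r // ?nnegrE].
  by apply: ler_wnM2r; [rewrite subr_le0 ltW | rewrite lerXn2r // ?nnegrE // ltW].
have le2 : D ^+ k * (av (fun f => homI B f * common_frac B f) - D * av (homI B))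
    <= av (fun f => homI B f * common_frac B f ^+ k.+1) -
       D * av (fun f => homI B f * common_frac B f ^+ k).
  rewrite -!mulNr -!avZ -!avD -avZ; apply: ler_av => f.
  have := ler_wpM2l (homI_ge0 B f) (leD f); rewrite [_ ^+ k.+1]exprSr.
  move: (homI B f) (common_frac B f) (D ^+ k) (_ ^+ k) => h x Dk xk; lra.
have Dk0 : 0 <= D ^+ k by rewrite exprn_ge0.
have Dk1 : D ^+ k <= 1 by rewrite exprn_ile1.
have le3 : - eps <= D ^+ k * - eps by rewrite mulrN lerN2 ler_piMl.
have le4 : D ^+ k * - eps <=
    D ^+ k * (av (fun f => homI B f * common_frac B f) - D * av (homI B)).
  by apply: ler_wpM2l => //; rewrite lerBrDl; lra.
by rewrite lerBlDl -lerBlDr -lerN2 opprB; lra.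
Qed.

(* Non-adjacency is transitive on [Y], i.e. [H] is complete multipartite on [Y]. *)
Definition cotransitive Y := {in Y & &, forall x y z, H x z -> H x y || H y z}.

Lemma cotransitiveS S Y : S \subset Y -> cotransitive Y -> cotransitive S.
Proof. by move=> /subsetP sSY cY x y z /sSY xY /sSY yY /sSY zY; exact: cY. Qed.

(** Non-adjacency is an equivalence relation on [v |: S], with [v |: A] the class of [v]. *)
Lemma nonadj_class S v :
  let A := [set x in S | ~~ H x v] in let B := [set x in S | H x v] in
  cotransitive (v |: S) ->
  [/\ S = A :|: B, [disjoint A & B], {in v |: A &, forall x y, ~~ H x y}
    & {in v |: A & B, forall x y, H x y}].
Proof.
move=> A B cS; split.
- by apply/setP => x; rewrite !inE; case: (x \in S); case: (H x v).
- by rewrite -setI_eq0; apply/eqP/setP => x; rewrite !inE; case: (H x v); rewrite ?andbF.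
- have inS x : x \in v |: A -> x \in v |: S.
    by rewrite !inE => /orP[->|/andP[-> _]] //; rewrite orbT.
  have nv x : x \in v |: A -> ~~ H x v.
    by rewrite !inE => /orP[/eqP-> | /andP[]] //; rewrite adj_irr.
  move=> x y xA yA; apply/negP => Hxy.
  have /orP[] := cS x v y (inS x xA) (setU11 v S) (inS y yA) Hxy.
    by rewrite (negPf (nv x xA)).
  by rewrite adj_sym (negPf (nv y yA)).
- move=> x y xA; rewrite inE => /andP[yS Hyv].
  have xS : x \in v |: S.
    by move: xA; rewrite !inE => /orP[->|/andP[-> _]] //; rewrite orbT.
  have yS' : y \in v |: S by rewrite inE yS orbT.
  have /orP[|] := cS y x v yS' xS (setU11 v S) Hyv; first by rewrite adj_sym.
  by move: xA; rewrite !inE => /orP[/eqP->|/andP[_ /negPf->]] //; rewrite adj_irr.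
Qed.

(** Let [A] be the class of a vertex [u] of [B] and [B'] the rest. [av_common_fracU] reduces to the
    moment of order [#|A|.+1] over [B']; the induction hypothesis, lifted by [av_moment_succ],
    lowers the order to [#|A|], which gives the density of [B]. *)
Lemma av_common_frac B : cotransitive B ->
  d ^+ #|B| * av (homI B) - #|B|%:R * rho <= av (fun f => homI B f * common_frac B f).
Proof.
have [m] := ubnP #|B|; elim: m => // m IHm in B *; rewrite ltnS => leB cB.
have [B0|[u uB]] := set_0Vmem B.
  rewrite B0 cards0 mul0r subr0 mul1r; apply: ler_av => f.
  suff -> : common_frac set0 f = 1 by rewrite mulr1.
  rewrite /common_frac -sum_natb_set (eq_bigr (fun=> 1)).
    by rewrite sumr_const mulfV // gt_eqF.
  by move=> w _; rewrite inE; case: forall_inP => // -[] x; rewrite inE.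
have uBE : u |: B = B by apply/setUidPr; rewrite sub1set.
have := @nonadj_class B u; rewrite uBE => /(_ cB).
set A := [set x in B | ~~ _]; set B' := [set x in B | _] => -[BE dAB A0 AB].
have uA : u \in A by rewrite inE uB adj_irr.
have uAE : u |: A = A by apply/setUidPr; rewrite sub1set.
rewrite {}uAE in A0 AB.
have cardB : (#|B| = #|A| + #|B'|)%N.
  by rewrite BE cardsU (disjoint_setI0 dAB) cards0 subn0.
have ltB' : (#|B'| < m)%N.
  by apply: leq_trans leB; rewrite cardB -addn1 addnC leq_add2r card_gt0; apply/set0Pn; exists u.
have sB'B : B' \subset B by rewrite BE subsetUr.
have IH := IHm B' ltB' (cotransitiveS sB'B cB).
have eps0 : 0 <= #|B'|%:R * rho by rewrite mulr_ge0 // ltW.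
have D0 : 0 <= d ^+ #|B'| by rewrite exprn_ge0.
have D1 : d ^+ #|B'| <= 1 by rewrite exprn_ile1.
have IHk := av_moment_succ #|A| D0 D1 eps0 IH.
have := av_common_fracU dAB A0 AB; rewrite -BE; apply: le_trans.
rewrite [in av (homI B)]BE (av_homIU dAB A0 AB) cardB exprD natrD mulrDl opprD addrA.
rewrite addrAC lerD2r -mulrA.
apply: le_trans (ler_wpM2l _ IHk); last by rewrite exprn_ge0.
by rewrite mulrBr lerD2l lerN2 ler_piMl // exprn_ile1.
Qed.

(** [v] enlarges its class by one vertex, so both densities are moments, of consecutive orders, of
    [common_frac B], where [B] is the set of neighbours of [v] in [S]. *)
Lemma av_homI_add S v : v \notin S -> cotransitive (v |: S) ->
  d ^+ #|[set x in S | H x v]| * av (homI S) - #|V|%:R * rho <= av (homI (v |: S)).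
Proof.
move=> vS cS; have [] := nonadj_class cS.
set A := [set x in S | ~~ _]; set B := [set x in S | _] => SE dAB A0 AB.
have dvAB : [disjoint v |: A & B].
  by rewrite -setI_eq0 setIUl setU_eq0 !setI_eq0 dAB andbT disjoints1 inE (negPf vS).
have vSE : v |: S = (v |: A) :|: B by rewrite -setUA -SE.
have A0' : {in A &, forall x y, ~~ H x y}.
  by move=> x y xA yA; apply: A0; rewrite inE ?xA ?yA orbT.
have AB' : {in A & B, forall x y, H x y}.
  by move=> x y xA yB; apply: AB; rewrite // inE xA orbT.
rewrite vSE (av_homIU dvAB A0 AB) [in homI S]SE (av_homIU dAB A0' AB').
rewrite cardsU1 inE (negPf vS) /= add1n.
have sBS : B \subset v |: S by rewrite vSE subsetUr.
have eps0 : 0 <= #|B|%:R * rho by rewrite mulr_ge0 // ltW.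
apply: le_trans (av_moment_succ #|A| _ _ eps0 (av_common_frac (cotransitiveS sBS cS))).
- by rewrite lerD2l lerN2 ler_wpM2r ?ler_nat ?max_card // ltW.
- by rewrite exprn_ge0.
- by rewrite exprn_ile1.
Qed.

Definition edges_in X : {set {set V}} := [set e in edges H | e \subset X].

Lemma edges_in_add S v : v \notin S ->
  (#|edges_in S| + #|[set x in S | H x v]| <= #|edges_in (v |: S)|)%N.
Proof.
move=> vS; set B := [set x in S | _]; pose E := [set [set x; v] | x in B].
have cE : #|E| = #|B|.
  apply: card_in_imset => x y; rewrite !inE => /andP[xS _] /andP[yS _] /setP/(_ x).
  rewrite !inE eqxx /= => /esym/orP[/eqP//|/eqP xv]; by rewrite -xv xS in vS.
have dE : [disjoint edges_in S & E].
  rewrite -setI_eq0; apply/eqP/setP => e; rewrite !inE; apply/negP.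
  move=> /andP[/andP[_ /subsetP eS] /imsetP[x _ eE]].
  by move/negP: vS; apply; apply: eS; rewrite eE !inE eqxx orbT.
rewrite -cE -[leqLHS]subn0 -[X in (_ - X)%N](cards0 {set V}) -(disjoint_setI0 dE) -cardsU.
apply/subset_leq_card/subsetP => e; rewrite !inE => /orP[/andP[-> eS]|/imsetP[x]].
  by rewrite (subset_trans eS) ?subsetUr.
rewrite inE => /andP[xS Hxv] ->; apply/andP; split.
  by rewrite /edges; apply/imsetP; exists (x, v).
by rewrite subUset !sub1set !inE xS eqxx orbT.
Qed.

Lemma edges_inS S Y : S \subset Y -> edges_in S \subset edges_in Y.
Proof.
by move=> sSY; apply/subsetP => e; rewrite !inE => /andP[-> /subset_trans]; exact.
Qed.

Lemma av_homI_ext S Y : S \subset Y -> cotransitive Y ->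
  d ^+ (#|edges_in Y| - #|edges_in S|) * av (homI S) - #|Y :\: S|%:R * (#|V|%:R * rho)
    <= av (homI Y).
Proof.
have [m] := ubnP #|Y :\: S|; elim: m => // m IHm in Y *; rewrite ltnS => leY sSY cY.
have [YS0|[v]] := set_0Vmem (Y :\: S).
  have -> : Y = S by apply/eqP; rewrite eqEsubset sSY andbT -setD_eq0 YS0.
  by rewrite subnn mul1r setDv cards0 mul0r subr0.
rewrite inE => /andP[vS vY].
pose Y' := Y :\ v.
have YE : Y = v |: Y' by rewrite setD1K.
have vY' : v \notin Y' by rewrite !inE eqxx.
have sSY' : S \subset Y' by rewrite subsetD1 sSY vS.
have cardY : #|Y :\: S| = #|Y' :\: S|.+1.
  rewrite (cardsD1 v) inE vS vY add1n; congr (#|pred_of_set _|.+1).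
  by apply/setP => x; rewrite !inE; case: (x == v); case: (x \in S).
have ltY' : (#|Y' :\: S| < m)%N by rewrite -ltnS -cardY.
have sY'Y : Y' \subset Y by rewrite subD1set.
have IH := IHm Y' ltY' sSY' (cotransitiveS sY'Y cY).
have := @av_homI_add Y' v vY'; rewrite -YE => /(_ cY); apply: le_trans.
have := edges_in_add vY'; rewrite -YE; set deg := #|[set _ in _ | _]| => ledeg.
have leS : (#|edges_in S| <= #|edges_in Y'|)%N by rewrite subset_leq_card ?edges_inS.
have D0 : 0 <= d ^+ deg by rewrite exprn_ge0.
have D1 : d ^+ deg <= 1 by rewrite exprn_ile1.
rewrite cardY -natr1 [X in _ - X]mulrDl mul1r opprD addrA lerD2r.
apply: le_trans (ler_wpM2l D0 IH); rewrite mulrBr; apply: lerB.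
  rewrite [leRHS]mulrA -exprD ler_wpM2r ?av_ge0 //.
  (* As [d <= 1], it suffices to compare exponents, and adding [v] adds at least its degree in new
     edges. *)
  by rewrite ler_wiXn2l // addnBA // leq_sub2r // addnC.
by rewrite ler_piMl // mulr_ge0 // mulr_ge0 // ltW.
Qed.

End Homs.

(** * Gluing along a tree *)

(** If the sum were smaller, the mean, hence its power bounding the product by AM-GM, would be below
    1. *)
Lemma sum_ge_size_prod1 (R : realType) (s : seq R) :
  all (fun x => 0 < x) s -> \prod_(x <- s) x = 1 -> (size s)%:R <= \sum_(x <- s) x.
Proof.
move=> s0 p1; case: (posnP (size s)) => [->|n0].
  by rewrite big_seq sumr_ge0 // => x /(allP s0) /ltW.
rewrite (big_nth 0) big_mkord in p1; rewrite (big_nth 0) big_mkord.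
have E0 : {in 'I_(size s), forall i : 'I_(size s), 0 <= s`_i}.
  by move=> i _; apply/ltW/(allP s0)/mem_nth.
have [] := leif_AGM E0; rewrite p1 card_ord => le1 _.
have S0 : 0 <= \sum_(i < size s) s`_i by rewrite sumr_ge0 // => i _; exact: E0.
by rewrite leNgt; apply: contraTN le1 => lt; rewrite -ltNge exprn_ilt1 -?lt0n // ?divr_ge0 //
  ltr_pdivrMr ?mul1r ?ltr0n.
Qed.

Section Gluing.
Variables (V : finType) (H : sgraph V).
Implicit Types (S X Y Z P : {set V}).

(* Swapping two bags by an involution of [V], rather than a bijection between them, makes it act
   on the maps [V -> W]. *)
Definition twins P Y := exists s : V -> V,
  [/\ involutive s, {in P, forall x, s x \in Y}, {in Y, forall x, s x \in P},
      {in Y :&: P, forall x, s x = x} & {in Y &, forall x y, H (s x) (s y) = H x y}].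

Variable X0 : {set V}.
Implicit Types L : seq ({set V} * {set V}).

Definition bags L := X0 :: unzip1 L.

(* Each pair [(Y, C)] of the list is a bag with its intersection with an earlier bag (the list
   grows at its head) through which [Y] meets all the earlier bags. *)
Fixpoint glued L : Prop :=
  if L is (Y, C) :: L' then
    glued L' /\ exists P, [/\ P \in bags L', C = Y :&: P,
      {in bags L', forall Z, Y :&: Z \subset P} & twins P Y]
  else True.

Definition bag_union L : {set V} := [set x | has (fun Z => x \in Z) (bags L)].

Lemma bag_subunion L Z : Z \in bags L -> Z \subset bag_union L.
Proof. by move=> ZL; apply/subsetP => x xZ; rewrite inE; apply/hasP; exists Z. Qed.

Lemma cap_bag_union L Y P : {in bags L, forall Z, Y :&: Z \subset P} ->
  Y :&: bag_union L \subset Y :&: P.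
Proof.
move=> YP; apply/subsetP => x; rewrite !inE => /andP[xY /hasP[Z ZL xZ]].
by rewrite xY; apply: (subsetP (YP Z ZL)); rewrite inE xY.
Qed.

Lemma bags_cons p L : bags (p :: L) =i p.1 :: bags L.
Proof. by move=> Z; rewrite /bags /= !inE orbCA. Qed.

Lemma bag_union_cons p L : bag_union L \subset bag_union (p :: L).
Proof.
apply/subsetP => x; rewrite !inE => /hasP[Z ZL xZ].
by apply/hasP; exists Z => //; rewrite bags_cons inE ZL orbT.
Qed.

(** An edge of [Y] shared with an earlier bag lies in [P], hence in [S]; all other edges of [Y] are
    new. *)
Lemma glued_edges L : glued L ->
  (#|edges_in H X0| + \sum_(p <- L) (#|edges_in H p.1| - #|edges_in H p.2|)
    <= #|\bigcup_(X in bags L) edges_in H X|)%N.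
Proof.
elim: L => [_|[Y S] L IHL /= [/IHL{}IHL [P [PL SE YP _]]]].
  rewrite big_nil addn0 subset_leq_card //.
  by apply: (bigcup_sup X0) => //; rewrite inE.
rewrite big_cons addnCA /=; set U := \bigcup_(X in _) _ in IHL.
have sSY : edges_in H S \subset edges_in H Y by apply: edges_inS; rewrite SE subsetIl.
have dU : [disjoint edges_in H Y :\: edges_in H S & U].
  rewrite -setI_eq0; apply/eqP/setP => e; rewrite !inE; apply/negP.
  move=> /andP[/andP[nS /andP[eH eY]] /bigcupP[Z ZL]]; rewrite inE eH /= => eZ.
  move: nS; rewrite eH SE subsetI eY /= => /negP; apply.
  by apply: subset_trans (YP Z ZL); rewrite subsetI eY.
rewrite -cardsDS //; apply: leq_trans (leq_add (leqnn _) IHL) _.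
have := cardsUI (edges_in H Y :\: edges_in H S) U.
rewrite (disjoint_setI0 dU) cards0 addn0 => <-.
apply/subset_leq_card/subsetP => e; rewrite in_setU => /orP[/setDP[eY _]|/bigcupP[Z ZL eZ]].
  by apply/bigcupP; exists Y => //; rewrite bags_cons inE eqxx.
by apply/bigcupP; exists Z => //; rewrite bags_cons inE ZL orbT.
Qed.

(** * The distribution built bag by bag *)

Variables (R : realType) (W : finType) (G : sgraph W).
Hypothesis W_gt0 : (0 < #|W|)%N.
Implicit Types (f g : {ffun V -> W}) (F : {ffun V -> W} -> R).

Local Notation hom X := (@homI R V W H G X).

Lemma mix_id S f : mix S f f = f.
Proof. by apply/ffunP => x; rewrite ffunE if_same. Qed.

Lemma cav_gt0 S F f : (forall g, 0 <= F g) -> 0 < F f -> 0 < cav S F f.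
Proof.
move=> F0 Ff; rewrite divr_gt0 ?exprn_gt0 ?cardW_gt0 //.
by rewrite (bigD1 f) //= mix_id ltr_wpDr // sumr_ge0.
Qed.

Lemma cav_eq0 S F f g : (forall g, 0 <= F g) -> cav S F f = 0 -> F (mix S f g) = 0.
Proof.
move=> F0 /eqP; rewrite mulf_eq0 invr_eq0 expf_eq0 (gt_eqF (cardW_gt0 R W_gt0)) andbF orbF.
rewrite psumr_eq0 // => /allP/(_ g); rewrite mem_index_enum => /(_ isT)/eqP; exact.
Qed.

Lemma twins_cav P Y f : twins P Y ->
  cav (Y :&: P) (hom Y) f = cav (Y :&: P) (hom P) f.
Proof.
case=> s [sK sP sY sYP sH]; set S := Y :&: P in sYP *; rewrite /cav /av; congr (_ / _).
pose c (g : {ffun V -> W}) := [ffun x => g (s x)].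
have cK : involutive c by move=> g; apply/ffunP => x; rewrite !ffunE sK.
rewrite (reindex_inj (inv_inj cK)); apply: eq_bigr => g _; rewrite /homI.
congr (_%:R); congr nat_of_bool.
have mE x : x \in Y -> mix S f (c g) x = mix S f g (s x).
  move=> xY; rewrite !ffunE; case: (boolP (x \in S)) => xS; first by rewrite sYP // xS.
  case: (boolP (s x \in S)) => // sxS.
  by move: (sYP _ sxS); rewrite sK => xE; rewrite -xE (negPf xS) in sxS.
apply/hom_onP/hom_onP => hf x y xX yX Hxy.
  rewrite -(sK x) -(sK y) -!mE ?sP //; apply: hf; rewrite ?sP //.
  by rewrite -sH ?sP // !sK.
by rewrite !mE //; apply: hf; rewrite ?sY // sH.
Qed.

Definition condhom (p : {set V} * {set V}) : {ffun V -> W} -> R := cav p.2 (hom p.1).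

(* Up to normalization, the density of the distribution obtained by choosing the bags one by one.
   Where [condhom p f = 0], also [hom p.1 f = 0], so the convention [0 / 0 = 0] is the right one. *)
Fixpoint weight L f : R :=
  if L is p :: L' then weight L' f * (hom p.1 f / condhom p f) else hom X0 f.

Lemma condhom_ge0 p f : 0 <= condhom p f.
Proof. by apply: av_ge0 => g; exact: homI_ge0. Qed.

Lemma weight_ge0 L f : 0 <= weight L f.
Proof.
elim: L => [|p L IHL] /=; first exact: homI_ge0.
by rewrite mulr_ge0 // divr_ge0 ?homI_ge0 ?condhom_ge0.
Qed.

Lemma weight_hom L f X : weight L f != 0 -> X \in bags L -> hom X f = 1.
Proof.
have homE Z : hom Z f != 0 -> hom Z f = 1 by rewrite /homI; case: hom_on; rewrite ?eqxx.
elim: L => [|p L IHL] /= wf; first by rewrite inE => /eqP->; exact: homE.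
move: wf; rewrite mulf_eq0 negb_or => /andP[wL]; rewrite mulf_eq0 negb_or => /andP[hp _].
by rewrite bags_cons inE => /predU1P[->|/IHL]; [exact: homE | exact].
Qed.

(** On the support all indicators are 1, so only the denominators remain; this supplies the product
    1 needed for AM-GM. *)
Lemma weight_inv L f : weight L f != 0 ->
  all (fun p => 0 < condhom p f) L /\ weight L f * \prod_(p <- L) condhom p f = 1.
Proof.
elim: L => [|p L IHL] wf /=.
  by rewrite big_nil mulr1 (weight_hom wf) // inE.
have hp : hom p.1 f = 1 by rewrite (weight_hom wf) // bags_cons inE eqxx.
move: wf => /=; rewrite hp mul1r mulf_eq0 negb_or invr_eq0 => /andP[/IHL[-> IH] q0].
rewrite lt_def q0 condhom_ge0; split=> //.
by rewrite big_cons mulrA divfK.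
Qed.

Lemma depends_condhom p : depends p.2 (condhom p).
Proof. exact: depends_cav. Qed.

Lemma dependsM U F1 F2 : depends U F1 -> depends U F2 -> depends U (fun f => F1 f * F2 f).
Proof. by move=> d1 d2 f g eqfg; rewrite (d1 _ _ eqfg) (d2 _ _ eqfg). Qed.

Lemma dependsV U F : depends U F -> depends U (fun f => (F f)^-1).
Proof. by move=> dF f g eqfg; rewrite (dF _ _ eqfg). Qed.

Lemma depends_weight L : glued L -> depends (bag_union L) (weight L).
Proof.
elim: L => [_|[Y S] L IHL /= [/IHL{}IHL [P [PL SE YP _]]]].
  by apply: dependsS (@depends_homI _ _ _ _ _ _); apply: bag_subunion; rewrite inE.
apply: dependsM; first by apply: dependsS IHL; exact: bag_union_cons.
have sY : Y \subset bag_union ((Y, S) :: L).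
  by apply: bag_subunion; rewrite bags_cons inE eqxx.
apply: dependsM; first by apply: dependsS sY _; exact: depends_homI.
by apply: dependsV; apply: dependsS (@depends_condhom _); rewrite SE (subset_trans (subsetIl _ _)).
Qed.

(** This is the uniformity of the marginal on each bag, with [F] as test function; it survives the
    addition of a bag because the new bag is a twin of an earlier one. *)
Lemma av_weight L X F : glued L -> X \in bags L -> depends X F ->
  av (fun f => weight L f * F f) = av (fun f => hom X f * F f).
Proof.
elim: L => [|[Y S] L IHL] in X F *; first by rewrite inE => _ /eqP->.
case=> gL [P [PL SE YP tw]]; rewrite bags_cons inE => XL dF.
have twE f : condhom (Y, S) f = cav S (hom P) f by rewrite /condhom SE twins_cav.
have dq : depends S (fun f => (condhom (Y, S) f)^-1).
  by apply: dependsV; exact: (@depends_condhom (Y, S)).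
have sSP : S \subset P by rewrite SE subsetIr.
have sSU : S \subset bag_union L by apply: subset_trans sSP (bag_subunion PL).
have sYU : Y :&: bag_union L \subset S by rewrite SE; exact: cap_bag_union.
have dw := depends_weight gL.
case: (boolP (X \in bags L)) => [{}XL | nXL].
  (* An earlier bag: averaging [hom Y] given [S] cancels the denominator, which is positive where
     the weight is. *)
  rewrite -(IHL X F) //.
  rewrite (eq_av (F2 := fun f => (weight L f * (condhom (Y, S) f)^-1 * F f) * hom Y f));
    last by move=> f /=; move: (hom Y f) (condhom _ f)^-1 => a b; ring.
  rewrite (av_indep W_gt0 _ (@depends_homI R V W H G Y) sSU sYU); last first.
    apply: dependsM; last by apply: dependsS dF; exact: bag_subunion.
    by apply: dependsM => //; apply: dependsS dq.
  apply: eq_av => f; case: (eqVneq (weight L f) 0) => [->|wf]; first by rewrite !mul0r.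
  have q0 : condhom (Y, S) f != 0.
    by rewrite gt_eqF // twE cav_gt0 // (weight_hom wf).
  by rewrite -[cav S (hom Y) f]/(condhom (Y, S) f) mulrAC divfK // mulrC.
(* The new bag: averaging given [S] leaves a function on [P], where the induction hypothesis turns
   the weight into [hom P]; its average given [S] equals the denominator, as [P] and [Y] are
   twins. *)
move: XL; rewrite (negPf nXL) orbF => /eqP XE; rewrite {X nXL}XE in dF *.
rewrite (eq_av (F2 := fun f => (weight L f * (condhom (Y, S) f)^-1) * (hom Y f * F f)));
  last by move=> f /=; move: (hom Y f) (condhom _ f)^-1 => a b; ring.
have dYF : depends Y (fun f => hom Y f * F f) by apply: dependsM => //; exact: depends_homI.
rewrite (av_indep W_gt0 _ dYF sSU sYU); last by apply: dependsM => //; apply: dependsS dq.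
pose C f := (condhom (Y, S) f)^-1 * cav S (fun f => hom Y f * F f) f.
have dC : depends S C by apply: dependsM => //; exact: depends_cav.
rewrite (eq_av (F2 := fun f => weight L f * C f)); last by move=> f; rewrite /C [RHS]mulrA.
rewrite (IHL P) //; last by apply: dependsS dC.
rewrite (eq_av (F2 := fun f => C f * hom P f)); last by move=> f; rewrite mulrC.
rewrite (av_indep W_gt0 dC (@depends_homI R V W H G P) (subxx S)) ?subsetIr //.
rewrite -[RHS](av_cav W_gt0 S); apply: eq_av => f; rewrite -twE /C mulrAC.
(* If the denominator vanishes, [hom Y] vanishes on every map agreeing with [f] on [S], so both
   sides are 0. *)
case: (eqVneq (condhom (Y, S) f) 0) => [q0|q0]; last by rewrite mulVf // mul1r.
rewrite q0 mulr0 mul0r /cav (eq_av (F2 := fun=> 0)) ?av_cst // => g.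
by rewrite (cav_eq0 g _ q0) ?mul0r // => h; exact: homI_ge0.
Qed.

(** Both are the total mass of [weight L]. *)
Lemma av_hom_bag L X : glued L -> X \in bags L -> av (hom X) = av (hom X0).
Proof.
move=> gL XL.
have wE Z : Z \in bags L -> av (hom Z) = av (weight L).
  move=> ZL; rewrite (eq_av (F2 := fun f => hom Z f * 1)); last by move=> f; rewrite mulr1.
  by rewrite -(av_weight gL ZL) //; apply: eq_av => f; rewrite mulr1.
by rewrite !wE // inE eqxx.
Qed.

(** With the marginal on [p.1], conditioning on [p.2] cancels the denominator and leaves the
    indicator of [condhom p f != 0], which forces a homomorphism on [p.2]. *)
Lemma av_weight_condhom L p : glued L -> p \in L ->
  av (fun f => weight L f / condhom p f) <= av (hom p.2).
Proof.
move=> gL pL; have pL' : p.1 \in bags L by rewrite inE; apply/orP; right; apply: map_f.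
have sp : p.2 \subset p.1.
  elim: L gL pL {pL'} => // -[Y S] L IHL [gL [P [_ SE _ _]]].
  by rewrite inE => /predU1P[->|/(IHL gL)] //=; rewrite SE subsetIl.
have dq : depends p.2 (fun f => (condhom p f)^-1) by apply: dependsV; exact: depends_condhom.
rewrite (av_weight gL pL') //; last by apply: dependsS dq.
rewrite (eq_av (F2 := fun f => (condhom p f)^-1 * hom p.1 f)); last by move=> f; rewrite mulrC.
rewrite (av_indep W_gt0 dq (@depends_homI R V W H G p.1) (subxx _)) ?subsetIr //.
apply: ler_av => f; rewrite -[cav _ _ f]/(condhom p f).
case: (eqVneq (condhom p f) 0) => [->|q0]; first by rewrite mulr0 homI_ge0.
rewrite mulVf // /homI; case: (boolP (hom_on H G p.2 f)) => // nf; case/negP: q0; apply/eqP.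
rewrite /condhom /cav (eq_av (F2 := fun=> 0)) ?av_cst // => g.
apply/eqP; rewrite pnatr_eq0 eqb0; apply: contra nf => hg.
have -> : hom_on H G p.2 f = hom_on H G p.2 (mix p.2 f g).
  by apply: depends_hom_on => x xS; rewrite ffunE xS.
have := @homI_sub R _ _ H G _ _ (mix p.2 f g) sp.
by rewrite /homI hg; case: hom_on => //; rewrite ler10.
Qed.

Lemma glued_lower_bound L : glued L -> 0 < av (hom X0) ->
  av (hom X0) * \prod_(p <- L) (av (hom X0) / av (hom p.2)) <=
    av (fun f => (weight L f != 0)%:R).
Proof.
move=> gL; set t := av (hom X0) => t0.
(* This scaling gives each [(k p)^-1 * (weight L f / condhom p f)] an average of at most [t]. *)
pose k (p : {set V} * {set V}) := av (hom p.2) / t.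
have k0 p : p \in L -> 0 < k p.
  move=> pL; rewrite divr_gt0 //; apply: lt_le_trans t0 _.
  have pL' : p.1 \in bags L by rewrite inE; apply/orP; right; apply: map_f.
  rewrite /t -(av_hom_bag gL pL'); apply: ler_av => f; apply: homI_sub.
  elim: L gL pL {pL'} => // -[Y S] L IHL [gL [P [_ SE _ _]]].
  by rewrite inE => /predU1P[->|/(IHL gL)] //=; rewrite SE subsetIl.
have kp : 0 < \prod_(p <- L) k p by rewrite big_seq prodr_gt0.
have AG f : (size L).+1%:R * weight L f <=
    (\prod_(p <- L) k p) * (weight L f != 0)%:R +
      \sum_(p <- L) (k p)^-1 * (weight L f / condhom p f).
  case: (eqVneq (weight L f) 0) => [->|wf] /=.
    by rewrite mulr0 mulr0 add0r big1 // => p _; rewrite mul0r mulr0.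
  have [/allP q0 wq] := weight_inv wf.
  have w0 : 0 < weight L f by rewrite lt_def wf weight_ge0.
  rewrite mulr1 -ler_pdivlMr // mulrDl mulr_suml.
  (* The numbers for AM-GM; their product is 1 because [weight L f] is the reciprocal of the product
     of the [condhom p f]. *)
  pose s := (\prod_(p <- L) k p) / weight L f :: [seq (k p)^-1 / condhom p f | p <- L].
  have -> : (size L).+1 = size s by rewrite /= size_map.
  apply: le_trans (sum_ge_size_prod1 _ _) _.
  - rewrite /= divr_gt0 //; apply/allP => _ /mapP[p pL ->].
    by rewrite divr_gt0 ?invr_gt0 ?k0 ?q0.
  - rewrite big_cons big_map [X in _ * X]big_split /= !prodfV mulrA mulrAC.
    rewrite -[X in X / _]mulrA -invfM wq invr1 mulr1 mulfV ?gt_eqF //.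
  rewrite big_cons big_map lerD2l ler_sum // => p _.
  by rewrite -[leRHS]mulrA [weight L f / _ / _]mulrAC mulfV ?gt_eqF // mul1r.
have := ler_av AG; rewrite avZ avD avZ.
set T := av (fun f => (weight L f != 0)%:R).
have -> : av (weight L) = t.
  rewrite (eq_av (F2 := fun f => weight L f * 1)) => [|f]; last by rewrite mulr1.
  rewrite (av_weight (X := X0)) ?inE ?eqxx //.
  by apply: eq_av => f; rewrite mulr1.
have -> : av (fun f => \sum_(p <- L) (k p)^-1 * (weight L f / condhom p f)) =
    \sum_(p <- L) (k p)^-1 * av (fun f => weight L f / condhom p f).
  rewrite [LHS](_ : _ = \sum_(p <- L) av (fun f => (k p)^-1 * (weight L f / condhom p f))).
    by apply: eq_bigr => p _; rewrite avZ.
  by rewrite /av exchange_big mulr_suml.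
have : \sum_(p <- L) (k p)^-1 * av (fun f => weight L f / condhom p f) <= (size L)%:R * t.
  rewrite mulr_natl big_seq.
  apply: (@le_trans _ _ (\sum_(p <- L | p \in L) t)).
    apply: ler_sum => p pL; rewrite ler_pdivrMl ?k0 //.
    by rewrite /k divfK ?gt_eqF //; exact: av_weight_condhom.
  by rewrite -big_seq big_const_seq count_predT iter_addr_0.
rewrite -natr1 mulrDl mul1r; move: (\sum_(_ <- _) _) => s les leS.
(* In the average of [AG], the [size L] summands take up at most [t] each, so one [t] is left on the
   other side. *)
have leKT : t <= \prod_(p <- L) k p * T by lra.
have -> : \prod_(p <- L) (t / av (hom p.2)) = (\prod_(p <- L) k p)^-1.
  by rewrite -prodfV; apply: eq_bigr => p _; rewrite /k [RHS]invf_div.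
by rewrite ler_pdivrMr // mulrC.
Qed.

End Gluing.

(** * Tree decompositions *)

Section Growing.
Variables (A : finType) (T : sgraph A) (root : A).
Implicit Types c : seq A.

Fixpoint grown c : Prop :=
  if c is Y :: c' then
    [/\ grown c', Y \notin root :: c' & exists2 P, P \in root :: c' & T P Y]
  else True.

(** While an edge leaves the list, the list grows; otherwise it is closed under adjacency, and
    connectedness makes it complete. *)
Lemma connected_grown : (forall x y, connect T x y) ->
  exists2 c, grown c & forall N, N \in root :: c.
Proof.
move=> Tconn; suff: forall m c, grown c -> (#|[predC root :: c]| < m)%N ->
    exists2 c', grown c' & forall N, N \in root :: c'.
  by move=> /(_ _ [::] I (ltnSn _)).
elim=> // m IHm c gc; rewrite ltnS => lem.
case: (pickP [pred p | [&& p.1 \in root :: c, p.2 \notin root :: c & T p.1 p.2]]).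
  move=> [P Y] /and3P[/= Pc Yc TPY]; apply: (IHm (Y :: c)); first by split=> //; exists P.
  apply: leq_trans lem; apply/proper_card/properP; split.
    by apply/subsetP => Z; rewrite !inE !negb_or => /and3P[-> _ ->].
  by exists Y; rewrite !inE ?eqxx ?orbT //; move: Yc; rewrite inE.
move=> noedge; exists c => // N.
have cl : closed T (mem (root :: c)).
  apply: intro_closed; first exact/sym_connect_sym/adj_sym.
  move=> P Y TPY Pc; apply: contraFT (noedge (P, Y)) => Yc.
  by rewrite /= Pc Yc TPY.
exact: etrans (esym (closed_connect cl (Tconn root N))) (mem_head root c).
Qed.

(** Each listed node is linked to an earlier one, so the list is connected through [root]; walks
    within it shorten to simple paths. *)
Lemma grown_path c P Z : grown c -> P \in root :: c -> Z \in root :: c ->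
  exists2 p, tree_path T P Z p & {subset P :: p <= root :: c}.
Proof.
pose e c := [rel x y | [&& x \in root :: c, y \in root :: c & T x y]].
have e_sym c' : connect_sym (e c').
  by apply: sym_connect_sym => x y /=; rewrite andbCA adj_sym.
have e_root c' X : grown c' -> X \in root :: c' -> connect (e c') root X.
  elim: c' X => [|Y c' IHc] X; first by rewrite inE => _ /eqP->; exact: connect0.
  case=> gc Yc [Q Qc TQY].
  have sub x : x \in root :: c' -> x \in [:: root, Y & c'].
    by rewrite in_cons => /predU1P[->|xc]; rewrite !inE ?eqxx // xc !orbT.
  have e_mono x y : connect (e c') x y -> connect (e (Y :: c')) x y.
    apply: connect_sub => a b /and3P[ac bc Tab]; apply: connect1.
    by rewrite /= Tab !sub.
  rewrite inE orbCA -in_cons => /predU1P[->|Xc]; last by apply: e_mono; exact: IHc.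
  apply: connect_trans (e_mono _ _ (IHc Q gc Qc)) (connect1 _).
  by rewrite /= TQY (sub _ Qc) !inE eqxx orbT.
move=> gc Pc Zc.
have: connect (e c) P Z.
  by apply: (@connect_trans _ _ root); [rewrite e_sym|]; exact: e_root.
case/connectP => p0 p0P ->.
case/shortenP: p0P => p pP pU _ {p0}; exists p.
  by split=> //; apply: sub_path pP => x y /and3P[].
elim: p P Pc pP {pU Z Zc} => [|y p IHp] x xc /=; first by move=> _ z; rewrite inE => /eqP->.
by case/andP=> /and3P[_ yc _] /(IHp _ yc) sub z; rewrite inE => /predU1P[->|/sub].
Qed.

End Growing.

Section Decomposition.
Variables (V : finType) (H : sgraph V).

(** If [x] and [z] lie in different parts, then [y] misses the part of one of them. *)
Lemma iso_cotransitive (l : nat) (r : 'I_l -> nat) (X : {set V}) f :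
  is_iso (induced H X) (complete_multipartite r) f -> cotransitive H X.
Proof.
move=> [_ fH] x y z xX yX zX; have HE u v : H (val u) (val v) = (tag (f u) != tag (f v)).
  by rewrite -[LHS]/(induced H X u v) -fH.
have := HE (exist _ x xX) (exist _ z zX); have := HE (exist _ x xX) (exist _ y yX).
have := HE (exist _ y yX) (exist _ z zX) => /= -> -> ->.
by case: (tag (f (exist _ x _)) =P tag (f (exist _ y _))) => [->|].
Qed.

(** The swap is [f] on [X], the inverse of [f] on the rest of [Y], and the identity elsewhere. *)
Lemma iso_twins (X Y : {set V}) f : is_iso (induced H X) (induced H Y) f ->
  (forall v, val v \in Y -> val (f v) = val v) -> twins H X Y.
Proof.
move=> [[g fK gK] fH] ffix.
pose s x := if insub x is Some u then val (f u) else
            if insub x is Some v then val (g v) else x.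
have sX x (xX : x \in X) : s x = val (f (exist _ x xX)) by rewrite /s insubT.
have sYX x (xY : x \in Y) : x \notin X -> s x = val (g (exist _ x xY)).
  by move=> nX; rewrite /s insubN // insubT.
have sXY x : x \in X -> s x \in Y by move=> xX; rewrite sX; exact: valP.
have s_fix x : x \in Y :&: X -> s x = x.
  by rewrite inE => /andP[xY xX]; rewrite sX ffix.
have s_YX x : x \in Y -> s x \in X.
  move=> xY; case: (boolP (x \in X)) => xX; last by rewrite (sYX _ xY xX); exact: valP.
  by rewrite s_fix // inE xY.
have sK : involutive s.
  move=> x; case: (boolP (x \in X)) => xX.
    case: (boolP (s x \in X)) => sxX.
      (* [f] fixes [X :&: Y], so a point of [X] sent into [X] is already fixed, by injectivity. *)
      have sxE : s (s x) = s x by rewrite s_fix // inE sxX sXY.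
      rewrite sxE; move: sxE; rewrite (sX _ sxX) {2}(sX _ xX).
      by move=> /val_inj/(can_inj fK)/(congr1 val).
    rewrite (sYX _ (sXY _ xX) sxX) -[RHS]/(val (exist (fun x => x \in X) x xX)).
    by rewrite -(fK (exist _ x xX)); congr (val (g _)); apply: val_inj; rewrite /= sX.
  case: (boolP (x \in Y)) => xY.
    rewrite (sX _ (s_YX _ xY)) -[RHS]/(val (exist (fun x => x \in Y) x xY)) -(gK (exist _ x xY)).
    by congr (val (f _)); apply: val_inj; rewrite /= (sYX _ xY xX).
  have sx : s x = x by rewrite /s !insubN.
  by rewrite !sx.
exists s; split=> // x y xY yY.
rewrite -{2}(sK x) -{2}(sK y) (sX _ (s_YX _ xY)) (sX _ (s_YX _ yY)).
by rewrite -[RHS]/(induced H Y _ _) fH.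
Qed.

(** The path from [P] to an earlier bag [Q] avoids the new node [Y], so it extends to a simple path
    from [Y] through [P], whence [Y :&: Q] lies in [P]. *)
Lemma grown_glued (F : {set {set V}}) (T : sgraph {X : {set V} | X \in F})
    (root : {X : {set V} | X \in F}) (c : seq {X : {set V} | X \in F}) :
    tree_decomposition H T ->
    (forall X Y, T X Y -> twins H (val X) (val Y)) -> grown T root c ->
  exists2 L, glued H (val root) L & bags (val root) L =i map val (root :: c).
Proof.
move=> [_ _ _ path_cap] Ttw; elim: c => [|Y c IHc]; first by exists [::].
case=> gc Yc [P Pc TPY]; have [L gL bL] := IHc gc.
exists ((val Y, val Y :&: val P) :: L); last first.
  by move=> Z; rewrite bags_cons inE bL /= !inE orbCA.
split=> //; exists (val P); split=> //; last exact: Ttw.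
  by rewrite bL map_f.
move=> Z; rewrite bL => /mapP[Q Qc ->].
have [p [pP pU pl] psub] := grown_path gc Pc Qc.
apply: (path_cap Y Q P (P :: p)); last by rewrite !inE eqxx orbT.
split=> //=; first by rewrite adj_sym TPY.
by rewrite -[(P \notin p) && _]/(uniq (P :: p)) pU andbT; apply: contra Yc => /psub.
Qed.

End Decomposition.

(** * Error terms and the final estimate *)

Lemma ler_prod_sub (R : realType) (I : eqType) (s : seq I) (x y : I -> R) (delta : R) :
    (forall i, i \in s -> [/\ 0 <= x i, x i <= 1, 0 <= y i, y i <= 1 & y i - delta <= x i]) ->
  0 <= delta ->
  \prod_(i <- s) y i - (size s)%:R * delta <= \prod_(i <- s) x i.
Proof.
move=> xy delta0; elim: s xy => [|i s IHs] xy; first by rewrite !big_nil mul0r subr0.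
have [x0 x1 y0 y1 xyi] := xy i (mem_head _ _).
have xys j : j \in s -> [/\ 0 <= x j, x j <= 1, 0 <= y j, y j <= 1 & y j - delta <= x j].
  by move=> js; apply: xy; rewrite inE js orbT.
have {}IHs := IHs xys; rewrite !big_cons /= -natr1 mulrDl mul1r.
have Y0 : 0 <= \prod_(j <- s) y j by rewrite big_seq prodr_ge0 // => j /xys[].
have Y1 : \prod_(j <- s) y j <= 1.
  by rewrite big_seq prodr_ile1 // => j /xys[_ _ -> ->].
have N0 : 0 <= (size s)%:R * delta by rewrite mulr_ge0.
move: (\prod_(j <- s) y j) (\prod_(j <- s) x j) ((size s)%:R * delta) IHs Y0 Y1 N0 => Y X N.
move: (x i) (y i) x0 x1 y0 y1 xyi => a b a0 a1 b0 b1 ab IHs Y0 Y1 N0.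
(* Telescoping: as all factors lie in [0, 1], the error of the head and that of the tail simply add
   up. *)
have h1 : a * (Y - N) <= a * X by rewrite ler_wpM2l.
have h2 : (b - delta) * Y <= a * Y by rewrite ler_wpM2r.
have h3 : a * N <= N by rewrite ler_piMl.
have h4 : Y * delta <= delta by rewrite ler_piMl.
lra.
Qed.

Lemma hom_densityE (R : realType) (V W : finType) (H : sgraph V) (G : sgraph W) :
  hom_density R H G = av (homI R H G [set: V]).
Proof.
rewrite /hom_density /av; congr (_ / _).
rewrite -sum1_card natr_sum big_mkcond; apply: eq_bigr => f _; rewrite /homI inE.
suff -> : hom_on H G [set: V] f = [forall x, forall y, H x y ==> G (f x) (f y)] by case: ifP.
apply/hom_onP/forallP => [h x|h x y _ _ Hxy]; last by have /forallP/(_ y)/implyP := h x; apply.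
by apply/forallP => y; apply/implyP; apply: h; rewrite inE.
Qed.

(** [beta] is the threshold below which the bag density makes the claim trivial, [delta] the loss
    per glued bag, and [eps] the loss of one extension; [eps = delta * beta] because that loss gets
    divided by a density of at least [beta]. *)
Lemma error_constants (R : realType) (eta : R) (m n : nat) : 0 < eta ->
  exists beta delta eps rho : R,
    [/\ [/\ 0 < beta, beta + beta <= eta & m%:R * delta + delta = beta],
        [/\ 0 < delta, 0 < eps & eps <= beta]
      & [/\ eps = delta * beta, 0 < rho, rho <= 1 & rho * n.+1%:R = eps]].
Proof.
move=> eta0.
have [beta [beta0 beta1 betaE]] : exists beta, [/\ 0 < beta, beta <= 1 & beta + beta <= eta].
  exists (Num.min eta 1 / 2); have min0 : 0 < Num.min eta 1 by rewrite lt_min eta0 ltr01.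
  have min_eta : Num.min eta 1 <= eta by rewrite ge_min lexx.
  have min_1 : Num.min eta 1 <= 1 by rewrite ge_min lexx orbT.
  by move: (Num.min eta 1) min0 min_eta min_1 => e e0 e1 e2; split; lra.
have [delta [delta0 delta_le deltaE]] : exists delta,
    [/\ 0 < delta, delta <= beta & m%:R * delta + delta = beta].
  exists (beta / m.+1%:R); split.
  - by rewrite divr_gt0.
  - by rewrite ler_pdivrMr // ler_peMr ?ler1n // ltW.
  - by rewrite -[X in _ + X]mul1r -mulrDl natr1 mulrC divfK // pnatr_eq0.
have [eps [eps0 eps_le epsE]] : exists eps, [/\ 0 < eps, eps <= delta & eps = delta * beta].
  by exists (delta * beta); split=> //; [rewrite mulr_gt0 | rewrite ler_piMr // ltW].
have [rho [rho0 rho1 rhoE]] : exists rho,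
    [/\ 0 < rho, rho <= 1 & rho * n.+1%:R = eps].
  exists (eps / n.+1%:R); split.
  - by rewrite divr_gt0.
  - rewrite ler_pdivrMr // mul1r (le_trans eps_le) // (le_trans delta_le) //.
    by rewrite (le_trans beta1) // ler1n.
  - by rewrite divfK // pnatr_eq0.
exists beta, delta, eps, rho; split=> //; split=> //.
exact: le_trans delta_le.
Qed.

(** Used with [D * Y] the ideal and [t * X] the actual product; the losses [N] and [eps] are at most
    [beta] each. *)
Lemma error_combination (R : realType) (E D X Y t N delta beta eps eta : R) :
    E <= D * Y -> D - eps <= t -> Y - N <= X -> N + delta = beta -> beta + beta <= eta ->
    0 <= D -> D <= 1 -> 0 <= X -> X <= 1 -> 0 <= N -> 0 < delta -> 0 < eps -> eps <= beta ->
  E - eta <= t * X.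
Proof.
move=> E_le t_ge X_ge NE betaE D0 D1 X0 X1 N0 delta0 eps0 eps_le.
have h1 : (D - eps) * X <= t * X by rewrite ler_wpM2r.
have h2 : D * (Y - N) <= D * X by rewrite ler_wpM2l.
have h3 : eps * X <= eps by rewrite ler_piMr // ltW.
have h4 : D * N <= N by rewrite ler_piMl.
lra.
Qed.

(* d is a density, hence d >= 0: for d < 0 every graph is (rho, d)-dense. *)
Theorem theorem1p4 (R : realType) (l : nat) (r : 'I_l -> nat)
    (V : finType) (H : sgraph V) :
  decomposable (complete_multipartite r) H ->
  forall eta : R, 0 < eta ->
  exists (rho : R) (n0 : nat), 0 < rho /\
    forall d : R, 0 <= d ->
    forall (W : finType) (G : sgraph W),
      (n0 <= #|W|)%N -> dense_graph rho d G ->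
      d ^+ #|edges H| - eta <= hom_density R H G.
Proof.
move=> [F [T [decT isoJ isoT]]] eta eta0.
have [[/card_gt0P[root _] Tconn _] _ Fedge _] := decT.
have twT X Y : T X Y -> twins H (val X) (val Y).
  by case/isoT => f fiso ffix; exact: iso_twins fiso ffix.
have cotr X : X \in F -> cotransitive H X by case/isoJ => f; exact: iso_cotransitive.
have [c gc cfull] := connected_grown root Tconn.
have [L gL bL] := grown_glued decT twT gc.
set X0 := val root in gL bL.
have bagF X : (X \in bags X0 L) = (X \in F).
  rewrite bL; apply/mapP/idP => [[Y _ ->]|XF]; first exact: valP.
  by exists (exist _ X XF).
have LF p : p \in L -> p.1 \in F.
  by move=> pL; rewrite -bagF inE; apply/orP; right; apply: map_f.
have Lsub p : p \in L -> p.2 \subset p.1.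
  elim: (L) gL => // -[Y S] L' IHL [gL' [P [_ SE _ _]]].
  by rewrite inE => /predU1P[->|/(IHL gL')] //=; rewrite SE subsetIl.
have [beta [delta [eps [rho [[beta0 betaE deltaE] [delta0 eps0 eps_le] [epsE rho0 rho1 rhoE]]]]]] :=
  error_constants (size L) (#|V| * #|V|) eta0.
exists rho, 1%N; split=> // d d0 W G W_gt0 dG.
have d1 : d <= 1 := dense_le1 rho1 W_gt0 dG.
have ext (S Y : {set V}) : S \subset Y -> Y \in F ->
    d ^+ (#|edges_in H Y| - #|edges_in H S|) * av (homI R H G S) - eps
      <= av (homI R H G Y).
  move=> sSY YF; apply: le_trans (av_homI_ext W_gt0 rho0 rho1 d0 dG sSY (cotr Y YF)).
  rewrite lerD2l lerN2 mulrA -natrM mulrC; apply: (@le_trans _ _ (rho * (#|V| * #|V|).+1%:R)).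
    by rewrite ler_pM2l // ler_nat leqW // leq_mul2r max_card orbT.
  by rewrite rhoE.
rewrite hom_densityE.
set t := av (homI R H G X0).
have X0F : X0 \in F by rewrite -bagF inE eqxx.
have t_ge : d ^+ #|edges_in H X0| - eps <= t.
  apply: le_trans (ext set0 X0 (sub0set _) X0F); rewrite lerD2r.
  have -> : av (homI R H G set0) = 1.
    rewrite -[RHS](av1 R V W_gt0); apply: eq_av => f; rewrite /homI.
    by suff -> : hom_on H G set0 f by []; apply/hom_onP => x y; rewrite inE.
  by rewrite mulr1 ler_wiXn2l // leq_subr.
have edgesE : (#|edges_in H X0| + \sum_(p <- L) (#|edges_in H p.1| - #|edges_in H p.2|)
    <= #|edges H|)%N.
  apply: leq_trans (glued_edges gL) _; apply/subset_leq_card/bigcupsP => X _.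
  by apply/subsetP => e; rewrite inE => /andP[].
have dE : d ^+ #|edges H| <= d ^+ #|edges_in H X0| *
    \prod_(p <- L) d ^+ (#|edges_in H p.1| - #|edges_in H p.2|).
  by rewrite -expr_sum -exprD ler_wiXn2l.
have tH0 : 0 <= av (homI R H G [set: V]) by apply: av_ge0 => f; exact: homI_ge0.
have D1 : d ^+ #|edges_in H X0| <= 1 by rewrite exprn_ile1.
(* If [t < beta], then [d ^+ #|edges H| <= t + eps <= eta] and the claim is trivial; otherwise
   dividing by the densities of the intersections is safe. *)
have [t_lt|t_beta] := ltP t beta.
  apply: le_trans tH0; rewrite subr_le0.
  apply: (@le_trans _ _ (d ^+ #|edges_in H X0|)); last first.
    apply: le_trans betaE; rewrite -lerBlDr; apply: le_trans (ltW t_lt).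
    by apply: le_trans t_ge; rewrite lerD2l lerN2.
  by rewrite ler_wiXn2l // (leq_trans _ edgesE) // leq_addr.
have t0 : 0 < t := lt_le_trans beta0 t_beta.
have := glued_lower_bound W_gt0 gL t0; rewrite -/t => lb.
(* Every edge lies in a bag, and maps of non-zero weight are homomorphisms on all bags. *)
have tH : av (fun f => (weight H X0 R G L f != 0)%:R) <= av (homI R H G [set: V]).
  apply: ler_av => f; rewrite ler_nat; case: (eqVneq (weight _ _ _ _ _ _) 0) => //= wf.
  suff -> : hom_on H G [set: V] f by [].
  apply/hom_onP => x y _ _ Hxy; have [X XF /andP[xX yX]] := Fedge x y Hxy.
  rewrite -bagF in XF; have := weight_hom wf XF.
  rewrite /homI; case: (hom_onP H G X f) => [hX _|_ /eqP]; first exact: hX.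
  by rewrite eq_sym oner_eq0.
apply: le_trans (le_trans lb tH).
pose x (p : {set V} * {set V}) := t / av (homI R H G p.2).
pose y (p : {set V} * {set V}) := d ^+ (#|edges_in H p.1| - #|edges_in H p.2|).
have xy p : p \in L -> [/\ 0 <= x p, x p <= 1, 0 <= y p, y p <= 1 & y p - delta <= x p].
  move=> pL; set k := av (homI R H G p.2).
  have tE : t = av (homI R H G p.1).
    by rewrite (av_hom_bag R G W_gt0 gL) // bagF LF.
  have tk : t <= k.
    by rewrite tE; apply: ler_av => f; apply: homI_sub; exact: Lsub.
  have k0 : 0 < k := lt_le_trans t0 tk.
  have x0 : 0 <= x p := divr_ge0 (ltW t0) (ltW k0).
  have x1 : x p <= 1 by rewrite ler_pdivrMr // mul1r.
  split=> //; [exact: exprn_ge0 | exact: exprn_ile1 |].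
  (* Dividing the extension bound by [k >= beta] turns its error [eps = delta * beta] into at most
     [delta]. *)
  rewrite ler_pdivlMr // mulrBl; have := ext _ _ (Lsub p pL) (LF p pL).
  rewrite -tE -/k -/(y p); apply: le_trans; rewrite lerD2l lerN2 epsE.
  by rewrite ler_pM2l // (le_trans t_beta).
have prod_ge := ler_prod_sub xy (ltW delta0).
have X_le1 : \prod_(p <- L) x p <= 1.
  by rewrite big_seq prodr_ile1 // => p /xy[-> ->].
have X_ge0 : 0 <= \prod_(p <- L) x p.
  by rewrite big_seq prodr_ge0 // => p /xy[].
apply: (error_combination dE t_ge prod_ge deltaE betaE) => //; first exact: exprn_ge0.
by rewrite mulr_ge0 // ltW.
Qed.
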